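(* Let $$w^\delta = k+\frac{\delta c \left(1+b\lambda+\ln\left(\frac{r-k}{c}\right)\right)+(1-\delta)(r-k)}{1+\delta b\lambda}.$$ Then $w^\delta<r$, and the contingent wholesale price contract with wholesale price $w^\delta$ in each generation and endogenous renewal probability coordinates the supply chain: $\tilde{x}(w^\delta,\delta)=b+\frac{1}{\lambda}\ln\left(\frac{r-k}{c}\right)=x^*$.
   Context: Parameters: capacity cost $c>0$ per unit, production cost $k\ge 0$ per unit, retail price $r$ with $r-k-c>c$, base demand $b\ge 0$, rate $\lambda>0$ with $\frac1\lambda\ge b$, discount factor $0<\delta<1$. Demand in each product generation is distributed as $b+A$ with $A\sim\mathrm{Exp}(\lambda)$, i.i.d. over generations. The first best (centralized) capacity is $x^*=b+\frac1\lambda\ln\left(\frac{r-k}{c}\right)$, the maximizer of $\Pi(x)=-cx+\mathbb{E}[(r-k)\min\{b+A,x\}]$. Contract with endogenous renewal probability: the OEM pays wholesale price $w$ per delivered unit, and the contract is renewed for the next generation only if the supplier's capacity $x$ meets the current generation's demand, so the renewal probability is $R(x)=1-e^{-\lambda(x-b)}$ for $x\ge b$ and $R(x)=0$ otherwise. With $\tilde{\pi}_s(x,w)=-cx+\mathbb{E}[(w-k)\min\{b+A,x\}]$, the supplier's net present value is $\tilde\pi_s^\delta(x)=\frac{\tilde\pi_s(x,w)}{1-\delta R(x)}$, and for $w\ge c+k$ the supplier's optimal capacity is $$\tilde{x}(w,\delta)=b+\frac{1}{\lambda} \ln\left(\frac{\delta}{1-\delta}W\left( \frac{1-\delta}{\delta}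 e^{ \frac{w-k}{\delta c}-1 + \frac{b\lambda(w-k-c)}{c}} \right)\right),$$ where $W$ is the (principal) Lambert function, the inverse of $y\mapsto ye^y$ on $[0,\infty)$. *)

(* Defs.v *)
From HB Require Import structures.
From mathcomp Require Import all_boot all_order all_algebra.
From mathcomp Require Import all_classical all_reals all_analysis.

Set Implicit Arguments.
Unset Strict Implicit.
Unset Printing Implicit Defensive.

Import Order.TTheory GRing.Theory Num.Theory.
Import numFieldNormedType.Exports.

Local Open Scope classical_set_scope.
Local Open Scope ring_scope.

Definition has_exponential_law (d : measure_display) (T : measurableType d)
    (R : realType) (P : probability T R) (lam : R) (A : {RV P >-> R}) : Prop :=
  forall V : set R, measurable V -> distribution P A V = exponential_prob lam V.

(* Principal branch on [0, +oo[: the inverse of y |-> y * exp y there.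
   Arguments z < 0 have no such preimage and get the junk value 0. *)
Definition lambertW (R : realType) (z : R) : R :=
  xget 0 [set y : R | 0 <= y /\ y * expR y = z].

Section model.
Context (d : measure_display) (T : measurableType d) (R : realType).
Variable P : probability T R.
Implicit Types (b c k r w p lam delta x : R) (A : T -> R).

(* Expected one-generation profit of a firm with capacity x that receives p per
   delivered unit: Pi(x) for p = r (the integrated chain), and the supplier's
   profit for p = w.  The integrand is integrable for exponential A, so [fine]
   loses nothing. *)
Definition generation_profit b c k p A x : R :=
  - c * x + fine ('E_P[(fun t => (p - k) * Num.min (b + A t) x)%R])%E.

Definition renewal_prob b A x : R := fine (P [set t | b + A t <= x]).

(* Demands being i.i.d. over generations, generation n is reached with
   probability R(x)^n, where R(x) := renewal_prob b A x; this is the sum of the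
   geometric series \sum_n (delta * R(x))^n * profit. *)
Definition supplier_npv b c k delta A w x : R :=
  generation_profit b c k w A x / (1 - delta * renewal_prob b A x).

End model.

Definition optimal_capacity (R : realType) (f : R -> R) (x : R) : Prop :=
  0 <= x /\ forall y, 0 <= y -> y != x -> f y < f x.

Definition first_best_capacity (R : realType) (b c k r lam : R) : R :=
  b + lam^-1 * ln ((r - k) / c).

Definition supplier_capacity (R : realType) (b c k lam w delta : R) : R :=
  b + lam^-1 * ln (delta / (1 - delta) *
    lambertW ((1 - delta) / delta *
      expR ((w - k) / (delta * c) - 1 + b * lam * (w - k - c) / c))).

Definition coordinating_price (R : realType) (b c k r lam delta : R) : R :=
  k + (delta * c * (1 + b * lam + ln ((r - k) / c)) + (1 - delta) * (r - k)) /
      (1 + delta * b * lam).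

(* Main.v *)
Require Import Defs.
From HB Require Import structures.
From mathcomp Require Import all_boot all_order all_algebra.
From mathcomp Require Import all_classical all_reals all_analysis.
From mathcomp Require Import measurable_realfun.
From mathcomp Require Import ring lra.

Import Order.TTheory GRing.Theory Num.Theory.
Import numFieldNormedType.Exports.

Local Open Scope classical_set_scope.
Local Open Scope ring_scope.

(** The wholesale price w and the renewal rule together give the supplier the
incentive of the integrated chain because, for exponential demand, the expected
delivery and the renewal probability vary together.  For a capacity y >= b the renewal
probability is R(y) = 1 - exp (- lam (y - b)), and the expected amount delivered is
b + R(y) / lam.  So the margin r - w that the supplier does not receive costs
it (r - w) (b + R(y) / lam), an affine function of R(y), whereas the value of
being renewed is also affine in R(y).  Write pi_s and Pi for the one-generation
profits of the supplier and of the chain.  With V = (r - w) / (lam delta) the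
terms in R(y) cancel, and for every price w

  pi_s(y) - V (1 - delta R(y)) = Pi(y) - (r - w) (b + 1 / (lam delta)).

The coordinating price is the one for which the constant subtracted on the
right is Pi(x_star) ([coordinating_margin]).  The identity then reads

  pi_s(y) - V (1 - delta R(y)) = Pi(y) - Pi(x_star)

([supplier_surplus]).  The right-hand side vanishes at x_star and is negative
elsewhere, and 1 - delta R(y) > 0; hence the net present value
pi_s(y) / (1 - delta R(y)) equals V at x_star and is smaller than V at any other
y >= b ([supplier_npv_lt]).  No derivative is taken.  The strict maximum of Pi
at x_star is itself the tangent inequality 1 + s < exp s for s <> 0, taken at
s = ln ((r - k) / c) - lam (y - b) ([first_best_profit_lt]).

Below b there is no renewal and every unit of capacity is sold, so profit grows
linearly as soon as the price exceeds k + c ([coordinating_price_gt]).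

Finally, substituting w in the Lambert formula gives W an argument of the form
z exp z with z = (1 - delta) / delta * ((r - k) / c), so that the formula
evaluates to x_star ([supplier_capacity_first_best]). *)

(** * Moments of exponential demand *)

Lemma exponential_prob_itvNycE (R : realType) (lam x : R) :
  exponential_prob lam `]-oo, x] = exponential_prob lam `[0, x].
Proof.
have -> : [set` `[0, x]] = `]-oo, x] `&` `[0, +oo[ :> set R.
  by apply/seteqP; split=> y /=; rewrite !in_itv/= andbT; lra.
rewrite /exponential_prob integral_mkcondr; apply: eq_integral => y _.
rewrite /exponential_pdf !patchE.
by case: ifPn => // y0; rewrite patchE y0.
Qed.

Lemma exponential_prob_itvNyc (R : realType) (lam x : R) :
  exponential_prob lam `]-oo, x] =
    (1 - expR (- lam * Num.max x 0))%:E.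
Proof.
rewrite exponential_prob_itvNycE.
have [x_gt0|x_le0] := ltP 0 x; first by rewrite exponential_prob_itv0c.
rewrite mulr0 expR0 subrr /exponential_prob.
have [->|x0] := eqVneq x 0; first by rewrite set_itv1 integral_set1.
by rewrite set_itv_ge ?integral_set0// bnd_simp -ltNge lt_neqAle x0.
Qed.

(** The part of the demand b + A served by the capacity that exceeds b is
[clamp (x - b) A] for x >= b.  Cutting at 0 as well makes the variable
nonnegative everywhere, and not only almost surely, so that the tail formula for
expectations applies. *)
Definition clamp {R : realType} (m x : R) : R := Num.min (Num.max x 0) m.

Lemma measurable_clamp {R : realType} (m : R) :
  measurable_fun setT (clamp m : R -> R).
Proof.
apply: measurable_minr => //.
exact: measurable_maxr.
Qed.

HB.instance Definition _ (R : realType) (m : R) :=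
  isMeasurableFun.Build _ _ _ _ (clamp m) (measurable_clamp m).

Section exponential_law.
Context {R : realType} {d : measure_display} {T : measurableType d}.
Context {P : probability T R} {A : {RV P >-> R}} {lam : R}.
Hypotheses (lam_gt0 : 0 < lam) (A_exp : has_exponential_law lam A).

Lemma exponential_law_cdf x :
  P [set t | A t <= x] = (1 - expR (- lam * Num.max x 0))%:E.
Proof. by rewrite -exponential_prob_itvNyc -A_exp. Qed.

Lemma exponential_law_ccdf x : 0 <= x ->
  P [set t | x < A t] = (expR (- lam * x))%:E.
Proof.
move=> x0.
have -> : [set t | x < A t] = ~` [set t | A t <= x].
  by apply/seteqP; split=> t /=; rewrite ltNge => /negP.
rewrite probability_setC; last first.
  rewrite -[X in measurable X]setTI.
  by apply: measurable_fun_le => //; exact: measurable_funPT.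
by rewrite exponential_law_cdf max_l// -[1%E]/(1%:E) -EFinB subKr.
Qed.

(** The exceptional set is taken to be A <= 0, which is null because the law has
no atom at 0; its measure is then a value of the distribution function. *)
Lemma exponential_law_ae_ge0 : {ae P, forall t, 0 <= A t}.
Proof.
exists [set t | A t <= 0]; split.
- rewrite -[X in measurable X]setTI.
  by apply: measurable_fun_le => //; exact: measurable_funPT.
- rewrite -[LHS]/(P [set t | A t <= 0]).
  by rewrite exponential_law_cdf maxxx mulr0 expR0 subrr.
- by move=> t /= /negP; rewrite -ltNge => /ltW.
Qed.

(** By the tail formula the expectation is the integral of P(A > y) over [0, m[.
The tail exp (- lam y) is 1 / lam times the density, so this integral is 1 / lam
times P(A <= m): the proportionality that aligns the supplier with the chain. *)
Lemma expectation_clamp_exponential (m : R) : 0 <= m ->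
  ('E_P[clamp m \o A] = (lam^-1 * (1 - expR (- lam * m)))%:E)%E.
Proof.
move=> m0; rewrite (@ge0_expectation_ccdf _ _ _ P (clamp m \o A)); last first.
  by move=> t /=; rewrite le_min le_max lexx orbT.
(* At y = m the tail of the clamped variable is 0 and the density is not, which
   forces the half-open interval. *)
transitivity (\int[lebesgue_measure]_(y in `[0%R, m[)
    (lam^-1%:E * (exponential_pdf lam y)%:E))%E.
  have -> : [set` `[0, m[] = `[0, +oo[ `&` `[0, m[ :> set R.
    by apply/seteqP; split=> y /=; rewrite !in_itv/= andbT; lra.
  rewrite integral_mkcondr; apply: eq_integral => y.
  rewrite inE /= in_itv/= andbT => y0; rewrite patchE /ccdf /distribution.
  have -> : pushforward P (clamp m \o A) [set` `]y, +oo[] =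
      P [set t | y < clamp m (A t)].
    by congr (P _); apply/seteqP; split=> t /=; rewrite in_itv/= andbT.
  case: ifPn; rewrite ?notin_setE ?inE /= in_itv/= y0/= => ym.
    rewrite exponential_pdfE// -EFinM mulrA mulVf ?gt_eqF// mul1r.
    rewrite -exponential_law_ccdf//; congr (P _); apply/seteqP; split => t /=;
      by rewrite /clamp lt_min lt_max ym andbT [y < 0]ltNge y0 orbF.
  rewrite (_ : [set _ | _] = set0) ?measure0//.
  apply/seteqP; split => t //=.
  by rewrite /clamp lt_min => /andP[_]; exact/negP/negP.
have mpdf : measurable_fun [set: R] (EFin \o exponential_pdf lam).
  by apply/measurable_EFinP; exact: measurable_exponential_pdf.
rewrite ge0_integralZl//.
- rewrite integral_itv_bndo_bndc; last exact: measurable_funTS.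
  rewrite EFinM; congr (_ * _)%E.
  rewrite -[X in 1 - expR (_ * X)](max_l m0) -exponential_prob_itvNyc.
  by rewrite exponential_prob_itvNycE.
- exact: measurable_funTS.
- by move=> y _; rewrite lee_fin exponential_pdf_ge0// ltW.
- by rewrite lee_fin invr_ge0 ltW.
Qed.

(** Almost surely A >= 0, and then min (b + A) x splits as the constant min b x
plus A clamped to [0, max (x - b) 0].  One formula thus covers capacities on
both sides of b. *)
Lemma expectation_delivery (p b x : R) :
  ('E_P[(fun t => p * Num.min (b + A t) x)%R])%E =
  (p * (Num.min b x + lam^-1 * (1 - expR (- lam * Num.max (x - b) 0))))%:E.
Proof.
set m : R := Num.max (x - b) 0.
have m0 : 0 <= m by rewrite le_max lexx orbT.
transitivity ('E_P[(p \o* (cst (Num.min b x) \+ (clamp m \o A)))%R])%E.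
  rewrite !unlock; apply: ae_eq_integral => //.
  - apply/measurable_EFinP; apply: measurable_funM => //.
    by apply: measurable_minr => //; exact: (measurable_funD (f := cst b)).
  - exact/measurable_EFinP/measurable_funM.
  - apply: filterS exponential_law_ae_ge0 => t At0 _ /=.
    rewrite mulrC /clamp (max_l At0); congr (_ * _)%:E.
    rewrite /m; case: (leP b x) => bx.
      rewrite max_l ?subr_ge0// addr_minr; congr Num.min; ring.
    rewrite max_r ?subr_le0 1?ltW// (min_r At0) addr0 min_r//; lra.
have clampL1 : clamp m \o A \in Lfun P 1.
  apply/Lfun1_integrable; apply: measurable_bounded_integrable => //.
  - by rewrite (le_lt_trans (probability_le1 P _)) ?ltry.
  - exists m; split; [exact: num_real|move=> M mM t _ /=].
    rewrite ger0_norm ?le_min ?le_max ?lexx ?orbT// /clamp.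
    by rewrite (le_trans _ (ltW mM))// ge_min lexx orbT.
have cstL1 : cst (Num.min b x) \in Lfun P 1 by exact: Lfun_cst.
rewrite expectationZl ?rpredD// expectationD// expectation_cst.
by rewrite expectation_clamp_exponential.
Qed.

Lemma renewal_prob_exponential b x :
  renewal_prob P b A x = 1 - expR (- lam * Num.max (x - b) 0).
Proof.
rewrite /renewal_prob -[LHS]/(fine (P _)).
have -> : [set t | b + A t <= x] = [set t | A t <= x - b].
  by apply/seteqP; split=> t /=; rewrite lerBrDl.
by rewrite exponential_law_cdf.
Qed.

Lemma generation_profit_exponential b c k p x :
  generation_profit P b c k p A x =
  - c * x + (p - k) * (Num.min b x + lam^-1 * renewal_prob P b A x).
Proof.
by rewrite /generation_profit expectation_delivery renewal_prob_exponential.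
Qed.
End exponential_law.

(** * Tools for locating the optimum *)

(** y * exp y is strictly increasing on the nonnegative reals, so y is the only
preimage of its value there. *)
Lemma lambertWK {R : realType} {y : R} : 0 <= y -> lambertW (y * expR y) = y.
Proof.
move=> y0; apply: xget_unique => // z [z0 ezy].
apply/eqP; case: (ltgtP z y) => // [zy|yz]; exfalso.
  suff : z * expR z < y * expR y by rewrite ezy ltxx.
  by apply: ltr_pM => //; rewrite ?expR_ge0// ltr_expR.
suff : y * expR y < z * expR z by rewrite ezy ltxx.
by apply: ltr_pM => //; rewrite ?expR_ge0// ltr_expR.
Qed.

(** Since q = exp (ln q), the last term is exp s with s = ln q - t, and this is
1 + s < exp s for s <> 0. *)
Lemma expR_tangent_ln {R : realType} {q t : R} : 0 < q -> t != ln q ->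
  1 + ln q < t + q * expR (- t).
Proof.
move=> q0 tq; rewrite -{2}(@lnK _ q)// -expRD.
have : ln q - t != 0 by rewrite subr_eq0 eq_sym.
by move=> /expR_gt1Dx; lra.
Qed.

Lemma optimal_capacity_past_base {R : realType} {f : R -> R} {b x : R} :
  0 <= b -> b < x ->
  (forall y, 0 <= y -> y < b -> f y < f b) ->
  (forall y, b <= y -> y != x -> f y < f x) ->
  optimal_capacity f x.
Proof.
move=> b0 bx lowb highx; split=> [|y y0 yx].
  by rewrite (le_trans b0) ?ltW.
have [yb|yb] := leP b y; first exact: highx.
by rewrite (lt_trans (lowb _ y0 yb))// highx// lt_eqF.
Qed.

(** * Coordination *)

Section coordination.
Context (R : realType) (d : measure_display) (T : measurableType d).
Context (P : probability T R) (A : {RV P >-> R}) (b c k r lam delta : R).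
Hypotheses (c_gt0 : 0 < c) (b_ge0 : 0 <= b) (lam_gt0 : 0 < lam).
Hypotheses (delta_gt0 : 0 < delta) (delta_lt1 : delta < 1).
Hypothesis A_exp : has_exponential_law lam A.
Hypothesis chain_profitable : k + c < r.

Local Notation profit p y := (generation_profit P b c k p A y).
Local Notation renewal y := (renewal_prob P b A y).
Local Notation npv y :=
  (supplier_npv P b c k delta A (coordinating_price b c k r lam delta) y).
Local Notation x_star := (first_best_capacity b c k r lam).
Local Notation w := (coordinating_price b c k r lam delta).
Local Notation q := ((r - k) / c).
Local Notation V := ((r - w) / (lam * delta)).

Let lam_neq0 : lam != 0. Proof. exact: lt0r_neq0. Qed.
Let c_neq0 : c != 0. Proof. exact: lt0r_neq0. Qed.

Let q_gt1 : 1 < q.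
Proof. by rewrite ltr_pdivlMr// mul1r ltrBrDl. Qed.

Let q_gt0 : 0 < q.
Proof. exact: lt_trans ltr01 q_gt1. Qed.

Let rE : r = k + c * q.
Proof. by rewrite mulrC divfK// addrC subrK. Qed.

Lemma first_best_gt_base : b < x_star.
Proof. by rewrite ltrDl mulr_gt0 ?invr_gt0 ?ln_gt0. Qed.

Lemma renewal_prob_below y : y <= b -> renewal y = 0.
Proof.
move=> yb; rewrite (renewal_prob_exponential A_exp).
by rewrite max_r ?subr_le0// mulr0 expR0 subrr.
Qed.

Lemma renewal_prob_above y : b <= y -> renewal y = 1 - expR (- (lam * (y - b))).
Proof.
move=> yb; rewrite (renewal_prob_exponential A_exp).
by rewrite max_l ?subr_ge0// mulNr.
Qed.

Lemma renewal_prob_first_best : renewal x_star = 1 - q^-1.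
Proof.
rewrite renewal_prob_above; last exact/ltW/first_best_gt_base.
rewrite /first_best_capacity [b + _]addrC addrK mulrA divff// mul1r.
by rewrite expRN lnK.
Qed.

Lemma generation_profit_below p y : y <= b -> profit p y = (p - k - c) * y.
Proof.
move=> yb; rewrite (generation_profit_exponential lam_gt0 A_exp).
by rewrite renewal_prob_below// min_r//; ring.
Qed.

Lemma generation_profit_above p y : b <= y ->
  profit p y = - c * y + (p - k) * (b + lam^-1 * renewal y).
Proof.
by move=> yb; rewrite (generation_profit_exponential lam_gt0 A_exp) min_l.
Qed.

(** In the variable t = lam (y - b), chain profit is a constant minus
c / lam * (t + q * exp (- t)), which [expR_tangent_ln] bounds. *)
Lemma first_best_profit_lt y : b <= y -> y != x_star ->
  profit r y < profit r x_star.
Proof.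
move=> yb yx; set t := lam * (y - b).
have yE : y = b + lam^-1 * t by rewrite /t mulrA mulVf// mul1r addrC subrK.
have tq : t != ln q.
  by apply: contra yx => /eqP tq; rewrite yE tq.
have := expR_tangent_ln q_gt0 tq; rewrite -subr_gt0 => tangent.
rewrite generation_profit_above// generation_profit_above; last first.
  exact/ltW/first_best_gt_base.
rewrite renewal_prob_first_best renewal_prob_above// -/t -subr_gt0.
rewrite {1}yE /first_best_capacity.
(* With q abstracted to Q, r occurs only as k + c * Q, and the comparison is a
   rational identity in ln Q and exp (- t). *)
move: rE q_gt0 tangent; set Q := q; set e := expR (- t) => -> Q0 tangent.
have -> : - c * (b + lam^-1 * ln Q) +
    (k + c * Q - k) * (b + lam^-1 * (1 - Q^-1)) -
    (- c * (b + lam^-1 * t) + (k + c * Q - k) * (b + lam^-1 * (1 - e))) =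
  c * lam^-1 * (t + Q * e - (1 + ln Q)).
  by field; rewrite lam_neq0 lt0r_neq0.
by rewrite !mulr_gt0 ?invr_gt0.
Qed.

Lemma first_best_optimal :
  optimal_capacity (generation_profit P b c k r A) x_star.
Proof.
apply: (optimal_capacity_past_base b_ge0 first_best_gt_base).
- move=> y y0 yb; rewrite !generation_profit_below// ?ltW//.
  by rewrite ltr_pM2l// -addrA -opprD subr_gt0.
- exact: first_best_profit_lt.
Qed.

Let den_gt0 : 0 < 1 + delta * b * lam.
Proof. by rewrite ltr_wpDr// !mulr_ge0// ltW. Qed.

(** This equation characterises the coordinating price: it is linear in w, and
solving it gives the closed formula. *)
Lemma coordinating_margin : (r - w) * (b + (lam * delta)^-1) = profit r x_star.
Proof.
rewrite generation_profit_above; last exact/ltW/first_best_gt_base.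
rewrite renewal_prob_first_best /coordinating_price /first_best_capacity.
move: rE q_gt0; set Q := q => -> Q0; field.
by rewrite !lt0r_neq0.
Qed.

(** Up to a positive factor, r - w is the sum of q - 1 - ln q > 0 and
b * lam * (q - 1) >= 0. *)
Lemma coordinating_price_lt : w < r.
Proof.
rewrite /coordinating_price; move: rE q_gt1; set Q := q => -> Q1.
have Q_tangent : 1 + ln Q < Q.
  rewrite -[ltRHS]lnK ?posrE ?(lt_trans ltr01)//.
  by rewrite expR_gt1Dx// gt_eqF// ln_gt0.
have fixed_part : 0 <= b * lam * (Q - 1).
  by rewrite !mulr_ge0 ?subr_ge0// ltW.
rewrite ltrD2l ltr_pdivrMr// -subr_gt0.
have -> : c * Q * (1 + delta * b * lam) - (delta * c * (1 + b * lam + ln Q) +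
    (1 - delta) * (k + c * Q - k)) =
    c * delta * (Q - (1 + ln Q) + b * lam * (Q - 1)) by ring.
by rewrite !mulr_gt0// ltr_wpDr// subr_gt0.
Qed.

(** Up to a positive factor, w - (k + c) is the convex combination of ln q and
q - 1 with weights delta and 1 - delta, both of them positive. *)
Lemma coordinating_price_gt : k + c < w.
Proof.
rewrite /coordinating_price; move: rE q_gt1; set Q := q => -> Q1.
rewrite ltrD2l ltr_pdivlMr// -subr_gt0.
have -> : delta * c * (1 + b * lam + ln Q) + (1 - delta) * (k + c * Q - k) -
    c * (1 + delta * b * lam) = c * (delta * ln Q + (1 - delta) * (Q - 1)).
  by ring.
by rewrite mulr_gt0// addr_gt0// mulr_gt0 ?subr_gt0// ln_gt0.
Qed.

Let discounted_gt0 y : 0 < 1 - delta * renewal y.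
Proof.
have : renewal y < 1.
  rewrite (renewal_prob_exponential A_exp).
  by rewrite gtrBl expR_gt0.
rewrite -(ltr_pM2l delta_gt0) mulr1 subr_gt0 => /lt_trans; exact.
Qed.

(** A supplier worth V has to earn V * (1 - delta * R) in one generation, the
part of V lost to discounting and to the risk of not being renewed.  What it falls
short of this is the profit that the chain forgoes by not building x_star. *)
Lemma supplier_surplus y : b <= y ->
  profit w y - V * (1 - delta * renewal y) = profit r y - profit r x_star.
Proof.
move=> yb; rewrite -coordinating_margin !generation_profit_above//.
by field; rewrite !lt0r_neq0.
Qed.

(** Comparing the ratio with V amounts to comparing its numerator with V times
its denominator, which [supplier_surplus] turns into a comparison of chain
profits. *)
Lemma supplier_npv_lt y : b <= y -> y != x_star -> npv y < npv x_star.
Proof.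
move=> yb yx.
have -> : npv x_star = V.
  apply: (canLR (mulfK (lt0r_neq0 (discounted_gt0 _)))); apply/eqP.
  by rewrite -subr_eq0 supplier_surplus ?subrr// ltW// first_best_gt_base.
rewrite ltr_pdivrMr// -subr_lt0 supplier_surplus// subr_lt0.
exact: first_best_profit_lt.
Qed.

Lemma supplier_npv_optimal :
  optimal_capacity (supplier_npv P b c k delta A w) x_star.
Proof.
apply: (optimal_capacity_past_base b_ge0 first_best_gt_base).
- move=> y y0 yb; rewrite /supplier_npv !renewal_prob_below// ?ltW//.
  rewrite mulr0 subr0 !divr1 !generation_profit_below// ?ltW//.
  by rewrite ltr_pM2l// -addrA -opprD subr_gt0 coordinating_price_gt.
- exact: supplier_npv_lt.
Qed.

Lemma supplier_capacity_first_best :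
  supplier_capacity b c k lam w delta = x_star.
Proof.
have ratio_gt0 : 0 < (1 - delta) / delta by rewrite divr_gt0// subr_gt0.
rewrite /supplier_capacity /first_best_capacity /coordinating_price.
move: rE q_gt0; set Q := q => -> Q0.
have -> : (k + (delta * c * (1 + b * lam + ln Q) +
      (1 - delta) * (k + c * Q - k)) / (1 + delta * b * lam) - k) / (delta * c)
    - 1 + b * lam * (k + (delta * c * (1 + b * lam + ln Q) +
      (1 - delta) * (k + c * Q - k)) / (1 + delta * b * lam) - k - c) / c =
    (1 - delta) / delta * Q + ln Q.
  by field; rewrite !lt0r_neq0.
rewrite expRD lnK// [expR _ * Q]mulrC mulrA lambertWK; last first.
  by rewrite mulr_ge0 ?ltW.
congr (_ + _ * ln _); field.
by rewrite !lt0r_neq0// subr_gt0.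
Qed.

End coordination.

Theorem proposition8 (R : realType) (d : measure_display)
  (T : measurableType d) (P : probability T R) (A : {RV P >-> R})
  (b c k r lam delta : R)
  (c_gt0 : 0 < c) (k_ge0 : 0 <= k) (r_large : c < r - k - c)
  (b_ge0 : 0 <= b) (lam_gt0 : 0 < lam) (b_le : b <= 1 / lam)
  (delta_gt0 : 0 < delta) (delta_lt1 : delta < 1)
  (A_exp : has_exponential_law lam A) :
  let w := coordinating_price b c k r lam delta in
  let x_star := first_best_capacity b c k r lam in
  let x_tilde := supplier_capacity b c k lam w delta in
  [/\ w < r,
      optimal_capacity (supplier_npv P b c k delta A w) x_tilde,
      x_tilde = b + 1 / lam * ln ((r - k) / c),
      x_tilde = x_star &
      optimal_capacity (generation_profit P b c k r A) x_star].
Proof.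
move=> w x_star x_tilde.
have chain_profitable : k + c < r by lra.
have x_tildeE : x_tilde = x_star by exact: supplier_capacity_first_best.
split=> //.
- exact: coordinating_price_lt.
- by rewrite x_tildeE; exact: supplier_npv_optimal.
- by rewrite x_tildeE div1r.
- exact: first_best_optimal.
Qed.
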